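(* Let $a<1$, $p\in(0,1)$, $\gamma_0>0$, $n\ge2$, and let $\boldsymbol z=(z_1,\ldots,z_n)\sim\mathrm{gCRSF}(n,\gamma_0,a,p)$. Then, conditionally on the sample size $n$, the sequential prediction rule is, for $i=1,\ldots,n-1$, $$P(z_{i+1}=k\mid z_{1:i},n,\gamma_0,a,p)=\begin{cases}(n_{k,(i)}-a)\,\dfrac{R_{n,\gamma_0,a,p}(i+1,\,l_{(i)})}{R_{n,\gamma_0,a,p}(i,\,l_{(i)})}, & k=1,\ldots,l_{(i)};\\[3mm] \gamma_0p^{-a}\,\dfrac{R_{n,\gamma_0,a,p}(i+1,\,l_{(i)}+1)}{R_{n,\gamma_0,a,p}(i,\,l_{(i)})}, & k=l_{(i)}+1,\end{cases}$$ where $z_{1:i}=(z_1,\ldots,z_i)$, $l_{(i)}$ is the number of clusters in $z_{1:i}$, and $n_{k,(i)}=\sum_{j=1}^i\mathbf 1(z_j=k)$.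
   Context: The generalized Chinese restaurant sampling formula $\mathrm{gCRSF}(n,\gamma_0,a,p)$ is the probability distribution on partitions of $\{1,\ldots,n\}$, encoded by cluster labels $\boldsymbol z=(z_1,\ldots,z_n)$ in order of appearance (so $z_1=1$ and each new cluster gets the next unused label), given by $$p(\boldsymbol z\mid n,\gamma_0,a,p)=\frac{\gamma_0^{l}p^{-al}}{\sum_{\ell=0}^n\gamma_0^\ell p^{-a\ell}S_a(n,\ell)}\prod_{k=1}^{l}\frac{\Gamma(n_k-a)}{\Gamma(1-a)},$$ where $l$ is the number of clusters and $n_k$ the size of cluster $k$. Here $S_a(n,l)=\frac{n!}{l!}\sum_{*}\prod_{k=1}^l\frac{\Gamma(n_k-a)}{n_k!\,\Gamma(1-a)}$ for $1\le l\le n$, with $\sum_*$ over all $l$-tuples of positive integers summing to $n$, and $S_a(n,0)=0$ for $n\ge1$. $R_{n,\gamma_0,a,p}(i,j)$ is defined for $1\le j\le i\le n$ by $R_{n,\gamma_0,a,p}(n,j)=1$ and, for $i=n-1,n-2,\ldots,1$, $$R_{n,\gamma_0,a,p}(i,j)=R_{n,\gamma_0,a,p}(i+1,j)\,(i-aj)+R_{n,\gamma_0,a,p}(i+1,j+1)\,\gamma_0p^{-a}.$$ *)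

(* Defs.v *)
From HB Require Import structures.
From mathcomp Require Import all_boot all_order all_algebra.
From mathcomp Require Import all_classical all_reals all_analysis.

Set Implicit Arguments.
Unset Strict Implicit.
Unset Printing Implicit Defensive.

Import Order.TTheory GRing.Theory Num.Theory.
Import numFieldNormedType.Exports.

Local Open Scope classical_set_scope.
Local Open Scope ring_scope.

Definition Gamma (R : realType) (x : R) : R :=
  \int[@lebesgue_measure R]_(t in `]0, +oo[) (t `^ (x - 1) * expR (- t)).

(* Labels are the positive integers 1, 2, ..., while positions in a sequence
   are counted from 0: z_j is [nth 0 z j.-1], and z_(1:i) is [take i z]. *)
Definition nb_clusters (s : seq nat) : nat := size (undup s).

Definition cluster_size (s : seq nat) (k : nat) : nat := count_mem k s.

Definition appearance_order (s : seq nat) : bool :=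
  [forall j : 'I_(size s),
     (nth 0%N s j \in take j s) ||
     (nth 0%N s j == (nb_clusters (take j s)).+1)].

(* S_a(n, l).  At l = 0 the outer sum ranges over the only 0-tuple, so the same
   formula gives S_a(n, 0) = 0 for n >= 1 (lemma [genStirling_n0]). *)
Definition genStirling (R : realType) (a : R) (n l : nat) : R :=
  n`!%:R / l`!%:R *
  \sum_(m : {ffun 'I_l -> 'I_n.+1} |
          [forall k, 0 < m k]%N && ((\sum_k m k)%N == n))
     \prod_(k < l) (Gamma ((m k)%:R - a) / ((m k)`!%:R * Gamma (1 - a))).

Lemma genStirling_n0 (R : realType) (a : R) (n : nat) :
  (0 < n)%N -> genStirling a n 0 = 0.
Proof.
move=> n0; rewrite /genStirling big_pred0 ?mulr0// => m.
by rewrite big_ord0 eq_sym (gtn_eqF n0) andbF.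
Qed.

Definition gCRSF (R : realType) (n : nat) (gamma0 a p : R)
    (z : n.-tuple nat) : R :=
  if appearance_order z then
    let l := nb_clusters z in
    gamma0 ^+ l * p `^ (- a * l%:R) /
      (\sum_(0 <= k < n.+1)
         gamma0 ^+ k * p `^ (- a * k%:R) * genStirling a n k) *
    \prod_(1 <= k < l.+1) (Gamma ((cluster_size z k)%:R - a) / Gamma (1 - a))
  else 0.

(* [predR_rec n gamma0 a p d j] is R(n - d, j). *)
Fixpoint predR_rec (R : realType) (n : nat) (gamma0 a p : R) (d j : nat) : R :=
  match d with
  | 0 => 1
  | d'.+1 => predR_rec n gamma0 a p d' j * ((n - d)%N%:R - a * j%:R) +
             predR_rec n gamma0 a p d' j.+1 * (gamma0 * p `^ (- a))
  end.

Definition predR (R : realType) (n : nat) (gamma0 a p : R) (i j : nat) : R :=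
  predR_rec n gamma0 a p (n - i) j.

Lemma predR_top (R : realType) (n : nat) (gamma0 a p : R) (j : nat) :
  predR n gamma0 a p n j = 1.
Proof. by rewrite /predR subnn. Qed.

Lemma predR_step (R : realType) (n : nat) (gamma0 a p : R) (i j : nat) :
  (i < n)%N ->
  predR n gamma0 a p i j =
    predR n gamma0 a p i.+1 j * (i%:R - a * j%:R) +
    predR n gamma0 a p i.+1 j.+1 * (gamma0 * p `^ (- a)).
Proof.
move=> lt_in; rewrite /predR -(subnSK lt_in) /=.
by rewrite (subnSK lt_in) (subKn (ltnW lt_in)).
Qed.

(* P(A | B) for an event B of positive probability; the value is 0 when
   P(B) = 0. *)
Definition cond_prob d (T : measurableType d) (R : realType)
    (P : probability T R) (A B : set T) : R :=
  fine (P (A `&` B)) / fine (P B).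

(* Main.v *)
(** Call [weight u] the unnormalised mass of a label sequence [u].  By
    [Gamma (x + 1) = x * Gamma x], appending an old label [k] multiplies it by
    [n_k - a], and appending the new label multiplies it by
    [gamma0 * p `^ (- a)].  Since the factors [n_k - a] add up to [i - a * l],
    backward induction on [i] along the recursion of [R] shows that the event
    [z_(1:i) = u] has probability [weight u * R(i, l) / C], where [C] is the
    denominator of the gCRSF; the prediction rule is the quotient of two such
    probabilities.  That [C] is nonzero follows from the case [i = 0], the total
    mass being 1. *)
Require Import Defs.
From HB Require Import structures.
From mathcomp Require Import all_boot all_order all_algebra.
From mathcomp Require Import all_classical all_reals all_analysis.
From mathcomp Require Import measurable_realfun.

Set Implicit Arguments.
Unset Strict Implicit.
Unset Printing Implicit Defensive.

Import Order.TTheory GRing.Theory Num.Theory.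
Import numFieldNormedType.Exports.

Local Open Scope classical_set_scope.
Local Open Scope ring_scope.

(** * Functional equation and positivity of the Gamma function *)

Section Gamma_function.
Context {R : realType}.
Local Notation mu := (@lebesgue_measure R).
Implicit Types x t : R.

Let integrand x t : R := t `^ (x - 1) * expR (- t).

(** Extended-real form of [Gamma], so that limits and the functional equation can be handled before
    finiteness is known. *)
Let eGamma x : \bar R := (\int[mu]_(t in `]0%R, +oo[) (integrand x t)%:E)%E.

Let integrand_ge0 x t : 0 <= integrand x t.
Proof. by rewrite mulr_ge0 ?powR_ge0 ?expR_ge0. Qed.

Let measurable_integrand x (D : set R) :
  measurable_fun D (EFin \o integrand x).
Proof.
apply/measurable_EFinP; apply: measurable_funTS; apply: measurable_funM => //.
by apply: measurableT_comp => //; exact: measurable_oppr.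
Qed.

Let itv_inv_nat_pos (n : nat) t :
  `[(n.+2%:R)^-1, n.+2%:R]%classic t -> 0 < t.
Proof.
by rewrite /= in_itv/= => /andP[+ _]; apply: lt_le_trans; rewrite invr_gt0.
Qed.

Let itv_inv_nat_lt (n : nat) : (n.+2%:R)^-1 < n.+2%:R :> R.
Proof.
apply: (@lt_trans _ _ 1); last by rewrite ltr1n.
by rewrite invf_lt1 ?ltr1n.
Qed.

(** These compact intervals stay away from 0, so integration by parts applies on each of them. The
    index [n.+2] makes them nondegenerate already at [n = 0]. *)
Let bigcup_itv_inv_nat :
  \bigcup_n `[(n.+2%:R)^-1, n.+2%:R]%classic = `]0, +oo[%classic :> set R.
Proof.
apply/seteqP; split=> [t [n _] /itv_inv_nat_pos|t].
  by rewrite /= in_itv/= andbT.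
rewrite /= in_itv/= andbT => t_gt0.
(* The truncation of [t] controls the right endpoint, that of [t^-1] the left one. *)
pose m := maxn (Num.truncn t) (Num.truncn t^-1); exists m => //=.
have le_m (u : R) : 0 <= u -> (Num.truncn u <= m)%N -> u <= m.+2%:R.
  move=> u0 um; apply: (@le_trans _ _ (Num.truncn u).+1%:R).
    by rewrite ltW// truncnS_gt.
  by rewrite ler_nat ltnS (leq_trans um).
rewrite in_itv/=; apply/andP; split; last by rewrite le_m ?leq_maxl// ltW.
rewrite -[leRHS]invrK lef_pV2 ?posrE ?invr_gt0//.
by rewrite le_m ?leq_maxr// invr_ge0 ltW.
Qed.

Let cvg_integrand x :
  (\int[mu]_(t in `[(n.+2%:R)^-1%R, n.+2%:R%R]) (integrand x t)%:E)%E
    @[n --> \oo] --> eGamma x.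
Proof.
rewrite /eGamma -bigcup_itv_inv_nat.
apply: ge0_nondecreasing_set_cvg_integral => //.
- apply/nondecreasing_seqP => n; rewrite subsetEset; apply: subset_itv.
  + by rewrite bnd_simp lef_pV2 ?posrE// ler_nat.
  + by rewrite bnd_simp ler_nat.
- by move=> n; exact: measurable_integrand.
- by move=> n t _; rewrite lee_fin integrand_ge0.
Qed.

Let continuous_powR (r t : R) : 0 < t -> {for t, continuous (@powR R ^~ r)}.
Proof.
move=> t0; apply/differentiable_continuous/derivable1_diffP.
by apply: derivable_powR; rewrite in_itv/= t0.
Qed.

Let continuous_expRN : continuous (fun t : R => expR (- t)).
Proof.
move=> t; apply: continuous_comp; last exact: continuous_expR.
exact: opp_continuous.
Qed.

Let by_parts x (a b : R) : 0 < a -> a < b ->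
  (\int[mu]_(t in `[a, b]) (integrand (x + 1) t)%:E =
   (a `^ x * expR (- a) - b `^ x * expR (- b))%:E
   + x%:E * \int[mu]_(t in `[a, b]) (integrand x t)%:E)%E.
Proof.
move=> a_gt0 lt_ab.
have b_gt0 : 0 < b by exact: lt_trans lt_ab.
have ab_gt0 t : t \in `[a, b] -> 0 < t.
  by rewrite in_itv/= => /andP[+ _]; exact: lt_le_trans.
have ab_gt0' t : t \in `]a, b[ -> 0 < t.
  by move=> tab; apply/ab_gt0/subset_itv_oo_cc.
rewrite /integrand.
under eq_integral do rewrite addrK.
rewrite (@integration_by_parts R (@powR R ^~ x) (fun t => - expR (- t))
  (fun t => x * t `^ (x - 1)) (fun t => expR (- t))) //.
(* Integrability lets the constant [x] leave the integral; it holds by continuity on a compact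
   interval that avoids 0. *)
- have int_f : mu.-integrable `[a, b] (EFin \o integrand x).
    apply: continuous_compact_integrable; first exact: segment_compact.
    apply: continuous_in_subspaceT => t /set_mem tab.
    apply: cvgM; last exact: continuous_expRN.
    exact: continuous_powR (ab_gt0 _ tab).
  rewrite !mulrN opprK [X in X%:E]addrC; congr (_ + _)%E.
  under eq_integral do rewrite mulrN -mulrA -mulNr EFinM.
  by rewrite integralZl//= EFinN mulNe oppeK.
- apply: continuous_in_subspaceT => t /set_mem tab.
  by apply: cvgM; [exact: cvg_cst|exact: continuous_powR (ab_gt0 _ tab)].
- split=> [t /ab_gt0' t_gt0| |].
  + by apply: derivable_powR; rewrite in_itv/= t_gt0.
  + exact/cvg_at_right_filter/continuous_powR.
  + exact/cvg_at_left_filter/continuous_powR.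
- by move=> t /ab_gt0' t_gt0; rewrite powR_derive1// in_itv/= t_gt0.
- exact: continuous_subspaceT.
- split=> [t _| |]; first exact: ex_derive.
  + by apply: cvg_at_right_filter; apply: cvgN; exact: continuous_expRN.
  + by apply: cvg_at_left_filter; apply: cvgN; exact: continuous_expRN.
- by move=> t _; rewrite derive1E derive_val mulrN1 opprK.
Qed.

Let cvg_inv_nat : (n.+2%:R^-1 : R) @[n --> \oo] --> 0.
Proof.
by have := @cvg_harmonic R; rewrite -(cvg_shiftS (@harmonic R)).
Qed.

Let cvg_boundary0 x : 0 < x ->
  ((n.+2%:R^-1) `^ x * expR (- n.+2%:R^-1) : R) @[n --> \oo] --> 0.
Proof.
move=> x_gt0.
have cvg_powR0 : ((n.+2%:R^-1) `^ x : R) @[n --> \oo] --> 0.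
  have /cvg_at_rightP := powR_cvg0 (R := R) x_gt0.
  by apply; split=> // n; rewrite invr_gt0.
apply: (squeeze_cvgr _ (cvg_cst 0) cvg_powR0).
near=> n; rewrite mulr_ge0 ?powR_ge0 ?expR_ge0//=.
by rewrite ler_piMr ?powR_ge0// expR_le1 oppr_le0 invr_ge0.
Unshelve. all: by end_near. Qed.

(** Take an integer [k > x] and write [b] for [n.+2%:R]. Then [b^x <= b^k] since [b >= 1], and the
    exponential series gives [exp(-b) <= (k+1)! / b^(k+1)], so the term is at most [(k+1)! / b]. *)
Let cvg_boundaryy x : 0 < x ->
  (n.+2%:R `^ x * expR (- n.+2%:R) : R) @[n --> \oo] --> 0.
Proof.
move=> x_gt0; pose k := (Num.truncn x).+1.
have cvg_bound : (k.+1`!%:R * n.+2%:R^-1 : R) @[n --> \oo] --> 0.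
  rewrite -[X in _ --> X](mulr0 k.+1`!%:R).
  by apply: cvgM cvg_inv_nat; exact: cvg_cst.
apply: (squeeze_cvgr _ (cvg_cst 0) cvg_bound).
near=> n; rewrite mulr_ge0 ?powR_ge0 ?expR_ge0//=.
have b_ge1 : (1 : R) <= n.+2%:R by rewrite ler1n.
apply: (@le_trans _ _ (n.+2%:R ^+ k * (k.+1`!%:R / n.+2%:R ^+ k.+1))).
  apply: ler_pM; rewrite ?powR_ge0 ?expR_ge0//.
    rewrite -powR_mulrn//; apply: ler_powR => //.
    by rewrite ltW// truncnS_gt.
  rewrite expRN -[leRHS]invrK lef_pV2 ?posrE ?expR_gt0 ?invr_gt0 ?divr_gt0//.
  rewrite invf_div; apply: le_trans (expR_ge1Dxn k _) => //.
  by rewrite lerDr.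
by rewrite exprS invfM mulrCA (mulrC (_^-1)) !mulrA mulfK//.
Unshelve. all: by end_near. Qed.

(** Limit of [by_parts] along the exhausting intervals; both boundary terms vanish because
    [x > 0]. *)
Let eGammaS x : 0 < x -> (eGamma (x + 1) = x%:E * eGamma x)%E.
Proof.
move=> x_gt0; rewrite -(cvg_lim _ (@cvg_integrand (x + 1)))//.
apply: cvg_lim => //.
rewrite -[X in _ --> X]add0e.
under eq_cvg => n.
  rewrite by_parts ?itv_inv_nat_lt ?invr_gt0//. over.
apply: cvgeD; [by []| |by apply: cvgeZl => //; exact: cvg_integrand].
apply: cvg_EFin; first by near=> n.
rewrite /comp/= -[X in _ --> X]subr0.
by apply: cvgB; [exact: cvg_boundary0|exact: cvg_boundaryy].
Unshelve. all: by end_near. Qed.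

Let eGamma_ge0 x : (0 <= eGamma x)%E.
Proof. by apply: integral_ge0 => t _; rewrite lee_fin integrand_ge0. Qed.

(** The integrand at 1 is the density of the exponential law of rate 1, whose total mass is 1. *)
Let eGamma1_lty : (eGamma 1 < +oo)%E.
Proof.
apply: (@le_lt_trans _ _ 1%E); last exact: ltry.
rewrite -(integral_exponential_pdf (@ltr01 R)).
rewrite /eGamma integral_mkcond.
apply: ge0_le_integral => //=.
- by move=> t _; apply: erestrict_ge0 => u _; rewrite lee_fin integrand_ge0.
- by apply/(measurable_restrictT (EFin \o integrand 1)).
- by apply/measurable_EFinP; exact: measurable_exponential_pdf.
move=> t _; rewrite patchE; case: ifPn => [|_].
  rewrite inE/= in_itv/= andbT lee_fin => t_gt0.
  rewrite exponential_pdfE; last exact: ltW.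
  by rewrite /integrand subrr powRr0 !mul1r mulN1r.
by rewrite lee_fin exponential_pdf_ge0.
Qed.

Let eGamma_nat_lty n : (eGamma n.+1%:R < +oo)%E.
Proof.
elim: n => [|n IHn]; first exact: eGamma1_lty.
rewrite -natr1 eGammaS// ltey_eq; apply/orP; left.
by rewrite fin_numM// ge0_fin_numE.
Qed.

(** Let [k] be an integer above [x - 1]. Then [t^(x-1)] is at most 1 for [t <= 1] and at most [t^k]
    for [t >= 1], so the integrand is dominated by the sum of those at 1 and at [k + 1]. *)
Let eGamma_ge1_lty x : 1 <= x -> (eGamma x < +oo)%E.
Proof.
move=> x_ge1; pose k := (Num.truncn (x - 1)).+1.
apply: (@le_lt_trans _ _ (eGamma 1 + eGamma k.+1%:R)%E); last first.
  by rewrite lte_add_pinfty// ?eGamma1_lty ?eGamma_nat_lty.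
rewrite /eGamma -ge0_integralD//=; last 4 first.
- by move=> t _; rewrite lee_fin integrand_ge0.
- exact: measurable_integrand.
- by move=> t _; rewrite lee_fin integrand_ge0.
- exact: measurable_integrand.
apply: ge0_le_integral => //=.
- by move=> t _; rewrite lee_fin integrand_ge0.
- exact: measurable_integrand.
- by apply: emeasurable_funD; exact: measurable_integrand.
move=> t; rewrite in_itv/= andbT => t_gt0.
rewrite -EFinD lee_fin /integrand -mulrDl ler_wpM2r ?expR_ge0//.
rewrite subrr powRr0 -natr1 addrK.
have [t_le1|/ltW t_ge1] := leP t 1.
  rewrite (@le_trans _ _ 1) ?lerDl ?powR_ge0//.
  rewrite [leRHS](_ : _ = 1 `^ (x - 1)); last by rewrite powR1.
  rewrite ge0_ler_powR ?subr_ge0// ?nnegrE//.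
  exact: ltW.
rewrite (@le_trans _ _ (t `^ k%:R)) ?lerDr// ler_powR//.
by rewrite ltW// truncnS_gt.
Qed.

(* For [0 < x < 1] finiteness is pulled back from [x + 1] by the functional
   equation, which holds in the extended reals. *)
Let eGamma_fin_num x : 0 < x -> eGamma x \is a fin_num.
Proof.
move=> x_gt0; rewrite ge0_fin_numE// ltNge leye_eq; apply/negP => /eqP eGx.
have : (eGamma (x + 1) < +oo)%E by rewrite eGamma_ge1_lty// lerDr ltW.
by rewrite eGammaS// eGx gt0_muley ?lte_fin// ltxx.
Qed.

Lemma GammaS x : 0 < x -> Gamma (x + 1) = x * Gamma x.
Proof.
move=> x_gt0; rewrite /Gamma /Rintegral -/(eGamma (x + 1)) eGammaS// fineM//.
exact: eGamma_fin_num.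
Qed.

(** On [[1, 2]] the integrand is at least [exp(-2)], and this interval has length 1. *)
Let Gamma_ge1_gt0 x : 1 <= x -> 0 < Gamma x.
Proof.
move=> x_ge1; apply: (@lt_le_trans _ _ (expR (- 2))); first exact: expR_gt0.
rewrite -lee_fin /Gamma /Rintegral fineK; last first.
  by apply: eGamma_fin_num; exact: lt_le_trans x_ge1.
have le12 : (1 : R) <= 2 by rewrite ler1n.
have -> : (expR (- 2))%:E = (\int[mu]_(t in `[1%R, 2%R]) (expR (- 2))%:E)%E.
  rewrite integral_cst//= lebesgue_measure_itv/= lte_fin ltr1n/=.
  by rewrite -EFinB -EFinM -[2 - 1]/(1 + 1 - 1) addrK mulr1.
apply: (@le_trans _ _ (\int[mu]_(t in `[1%R, 2%R]) (integrand x t)%:E)%E).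
  apply: ge0_le_integral => //=.
    exact: measurable_integrand.
  move=> t; rewrite in_itv/= => /andP[t_ge1 t_le2]; rewrite lee_fin.
  rewrite -[leLHS]mul1r ler_pM ?expR_ge0// ?ler_expR ?lerN2//.
  by rewrite -[leLHS](powRr0 t) ler_powR// subr_ge0.
apply: ge0_subset_integral => //=.
- exact: measurable_integrand.
- by move=> t _; rewrite lee_fin integrand_ge0.
- move=> t; rewrite /= !in_itv/= => /andP[t_ge1 _].
  by rewrite andbT (lt_le_trans _ t_ge1).
Qed.

Lemma Gamma_gt0 x : 0 < x -> 0 < Gamma x.
Proof.
move=> x_gt0; rewrite -(pmulr_rgt0 _ x_gt0) -GammaS// Gamma_ge1_gt0//.
by rewrite lerDr ltW.
Qed.

End Gamma_function.

(** * Label sequences in order of appearance, extended one label at a time *)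

Lemma appearance_order_all (s : seq nat) :
  appearance_order s =
  all (fun j => (nth 0%N s j \in take j s) ||
                (nth 0%N s j == (nb_clusters (take j s)).+1)) (iota 0 (size s)).
Proof.
apply/forallP/allP => [+ j | + j].
  by move=> /[swap]; rewrite mem_iota add0n => lt_js /(_ (Ordinal lt_js)).
by apply; rewrite mem_iota /=.
Qed.

Lemma appearance_order_rcons (s : seq nat) (k : nat) :
  appearance_order (rcons s k) =
  appearance_order s && ((k \in s) || (k == (nb_clusters s).+1)).
Proof.
rewrite !appearance_order_all size_rcons -addn1 iotaD all_cat/= andbT add0n.
rewrite nth_rcons ltnn eqxx -cats1 take_size_cat//; congr (_ && _).
apply: eq_in_all => j; rewrite mem_iota => /andP[_]; rewrite add0n => lt_js.
by rewrite nth_cat lt_js takel_cat// ltnW.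
Qed.

Lemma nb_clusters_rcons (s : seq nat) (k : nat) :
  nb_clusters (rcons s k) = ((k \notin s) + nb_clusters s)%N.
Proof.
rewrite /nb_clusters -(perm_size (perm_undup (s1 := k :: s) _)) /=.
  by case: ifP.
by move=> x; rewrite mem_rcons.
Qed.

Lemma cluster_size_rcons (s : seq nat) (j k : nat) :
  cluster_size (rcons s k) j = (cluster_size s j + (k == j))%N.
Proof. by rewrite /cluster_size -cats1 count_cat/= addn0. Qed.

Lemma mem_appearance_order (s : seq nat) (k : nat) :
  appearance_order s -> (k \in s) = (1 <= k <= nb_clusters s)%N.
Proof.
elim/last_ind: s k => [|s j IHs] k; first by case: k.
rewrite appearance_order_rcons => /andP[s_label].
rewrite mem_rcons inE nb_clusters_rcons (IHs k)//.
have [j_s _|j_s /= /eqP ->] := boolP (j \in s).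
  rewrite add0n; have [->|//] := eqVneq k j.
  by rewrite -(IHs j s_label) j_s.
by case: k => // k; rewrite eqSS add1n ltnS [RHS]leq_eqVlt.
Qed.

(** Double counting: each entry of [s] is counted by exactly one label between 1 and
    [nb_clusters s]. *)
Lemma sum_cluster_size (s : seq nat) : appearance_order s ->
  (\sum_(1 <= k < (nb_clusters s).+1) cluster_size s k)%N = size s.
Proof.
move=> s_label; rewrite -sum1_size.
under eq_bigr do rewrite /cluster_size -sum1_count big_mkcond.
rewrite exchange_big/= big_seq [RHS]big_seq; apply: eq_bigr => x x_s.
rewrite -big_mkcond/=.
under eq_bigl do rewrite eq_sym.
by rewrite big_nat1_eq ltnS -mem_appearance_order// x_s.
Qed.

(** * Unnormalised masses and their one-step recursion *)

Section weight.
Context {R : realType}.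
Variables (gamma0 a p : R).
Hypothesis a_lt1 : a < 1.

Definition gCRSF_weight (s : seq nat) : R :=
  (gamma0 * p `^ (- a)) ^+ nb_clusters s *
  \prod_(1 <= k < (nb_clusters s).+1)
     (Gamma ((cluster_size s k)%:R - a) / Gamma (1 - a)).

Local Notation weight := gCRSF_weight.

(** A label in use occurs at least once, and [1 > a]; this keeps all arguments of [Gamma]
    positive. *)
Let cluster_size_gt0 s k : appearance_order s ->
  (1 <= k <= nb_clusters s)%N -> 0 < (cluster_size s k)%:R - a.
Proof.
move=> s_label; rewrite -mem_appearance_order// -has_pred1 has_count => n_k_gt0.
by rewrite subr_gt0 (lt_le_trans a_lt1)// ler1n.
Qed.

Let Gamma1a_gt0 : 0 < Gamma (1 - a).
Proof. by rewrite Gamma_gt0// subr_gt0. Qed.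

Lemma gCRSF_weight_neq0 (s : seq nat) : appearance_order s ->
  gamma0 * p `^ (- a) != 0 -> weight s != 0.
Proof.
move=> s_label g_neq0; rewrite mulf_neq0 ?expf_neq0// gt_eqF//.
rewrite big_nat; apply: prodr_gt0 => k k_l.
by rewrite divr_gt0// Gamma_gt0// cluster_size_gt0.
Qed.

Lemma gCRSF_weight_old (s : seq nat) (k : nat) :
  appearance_order s -> (1 <= k <= nb_clusters s)%N ->
  weight (rcons s k) = weight s * ((cluster_size s k)%:R - a).
Proof.
move=> s_label k_l; rewrite /weight nb_clusters_rcons.
rewrite mem_appearance_order// k_l add0n -mulrA; congr (_ * _).
(* The extra factor is spread as a product over all clusters, equal to 1 except at [k], so that the
   two products can be compared factor by factor. *)
have -> : (cluster_size s k)%:R - a = \prod_(1 <= j < (nb_clusters s).+1)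
    (if j == k then (cluster_size s j)%:R - a else 1).
  by rewrite -big_mkcond/= big_nat1_eq ltnS k_l.
rewrite -big_split/=; apply: eq_big_nat => j; rewrite ltnS => j_l.
rewrite cluster_size_rcons eq_sym; case: eqP => _; last by rewrite addn0 mulr1.
by rewrite natrD addrAC GammaS ?cluster_size_gt0// -mulrA mulrC.
Qed.

Lemma gCRSF_weight_new (s : seq nat) : appearance_order s ->
  weight (rcons s (nb_clusters s).+1) = weight s * (gamma0 * p `^ (- a)).
Proof.
move=> s_label; rewrite /weight; set l := nb_clusters s.
have l1_s : l.+1 \notin s by rewrite mem_appearance_order// ltnn andbF.
rewrite nb_clusters_rcons l1_s add1n -/l exprSr mulrAC -!mulrA; congr (_ * _).
congr (_ * _).
(* The new cluster has size 1 and contributes [Gamma (1 - a) / Gamma (1 - a) = 1]. *)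
rewrite big_nat_recr//= cluster_size_rcons eqxx /cluster_size.
rewrite (count_memPn l1_s) add0n divff ?gt_eqF// mulr1.
apply: eq_big_nat => j /andP[_ j_l]; rewrite -/(cluster_size _ j).
by rewrite cluster_size_rcons gtn_eqF// addn0.
Qed.

(** One step of the law of total probability, up to the normaliser: the old labels produce the
    coefficient [i - a * l] of [predR_step], with [i = size s], and the new label produces the other
    one. *)
Lemma sum_gCRSF_weight_rcons (n : nat) (s : seq nat) : appearance_order s ->
  (size s < n)%N ->
  let l := nb_clusters s in
  \sum_(1 <= k < l.+1) weight (rcons s k) * predR n gamma0 a p (size s).+1 l
  + weight (rcons s l.+1) * predR n gamma0 a p (size s).+1 l.+1
  = weight s * predR n gamma0 a p (size s) l.
Proof.
move=> s_label lt_sn /=; rewrite [in RHS]predR_step// gCRSF_weight_new//.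
rewrite mulrDr; congr (_ + _); last by rewrite -mulrA [X in _ = _ * X]mulrC.
under eq_big_nat => k k_l do rewrite gCRSF_weight_old// mulrAC.
rewrite -mulr_sumr -mulrA; congr (_ * (_ * _)).
rewrite big_split/= -natr_sum sum_cluster_size// sumrN; congr (_ - _).
by rewrite sumr_const_nat subn1 mulr_natr.
Qed.

Lemma gCRSF_weightE (n : nat) (t : n.-tuple nat) : appearance_order t ->
  gCRSF gamma0 a p t = weight t /
    \sum_(0 <= k < n.+1) gamma0 ^+ k * p `^ (- a * k%:R) * genStirling a n k.
Proof.
move=> t_label.
rewrite /gCRSF t_label /weight exprMn powRrM powR_mulrn ?powR_ge0//.
by rewrite mulrAC.
Qed.

End weight.

(** * Probability of a prefix of the random labels *)

(** The type of tuples is countable, and a singleton is a finite intersection of preimages under the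
    coordinate maps. *)
Lemma measurable_tuple_nat (n : nat) (A : set (n.-tuple nat)) : measurable A.
Proof.
apply: countable_measurable => [t|]; last exact: countableP.
have -> : [set t] =
    \bigcap_(j in [set: 'I_n]) ((@tnth n nat)^~ j @^-1` [set tnth t j]).
  apply/seteqP; split=> [_ -> j//|u tu].
  by apply: eq_from_tnth => j; exact: tu.
apply: fin_bigcap_measurable => // j _.
by rewrite -[X in measurable X]setTI; apply: measurable_tnth.
Qed.

Section prefix_probability.
Context d (T : measurableType d) (R : realType) (P : probability T R).
Context (n : nat) (z : {RV P >-> n.-tuple nat}).

Let prefix_event (u : seq nat) : set T := [set w | take (size u) (z w) = u].

Lemma prefix_event_rcons (u : seq nat) (k : nat) : (size u < n)%N ->
  prefix_event (rcons u k) =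
  [set w | nth 0%N (z w) (size u) = k] `&` prefix_event u.
Proof.
move=> lt_un; apply/funext => w; apply/propext; rewrite /prefix_event/=.
rewrite size_rcons (take_nth 0%N) ?size_tuple//.
by split=> [/rcons_inj[-> ->]|[-> ->]].
Qed.

Lemma measurable_prefix_event (u : seq nat) : measurable (prefix_event u).
Proof.
have -> : prefix_event u =
    z @^-1` [set t : n.-tuple nat | take (size u) t = u] by [].
by rewrite -[X in measurable X]setTI; apply: measurable_funP => //;
  exact: measurable_tuple_nat.
Qed.

(** The event is partitioned by the value of the next label, which ranges over all natural numbers,
    hence a series. *)
Lemma prefix_event_series (u : seq nat) : (size u < n)%N ->
  (P (prefix_event u) = \sum_(k <oo) P (prefix_event (rcons u k)))%E.
Proof.
move=> lt_un.
have -> : prefix_event u = \bigcup_k prefix_event (rcons u k).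
  apply/seteqP; split=> [w uw|w [k _]]; last first.
    by rewrite prefix_event_rcons// => -[].
  by exists (nth 0%N (z w) (size u)) => //; rewrite prefix_event_rcons.
rewrite measure_bigcup//=.
- by apply: eq_eseriesl => k; rewrite in_setT.
- by move=> k _; exact: measurable_prefix_event.
- apply/trivIsetP => j k _ _ /eqP jk; apply/seteqP; split=> // w [].
  rewrite !prefix_event_rcons//= => -[zj _] [zk _].
  by case: jk; rewrite -zj.
Qed.

Variables (gamma0 a p : R).
Hypothesis a_lt1 : a < 1.
Hypothesis z_law : forall t : n.-tuple nat,
  distribution P z [set t] = (gCRSF gamma0 a p t)%:E.

Let normalizer : R :=
  \sum_(0 <= k < n.+1) gamma0 ^+ k * p `^ (- a * k%:R) * genStirling a n k.

Lemma prefix_probability (u : seq nat) : (size u <= n)%N ->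
  P (prefix_event u) = (if appearance_order u then
    gCRSF_weight gamma0 a p u * predR n gamma0 a p (size u) (nb_clusters u)
      / normalizer else 0)%:E.
Proof.
move=> le_un; have [m] := ubnP (n - size u).
elim: m u le_un => // m IHm u; rewrite leq_eqVlt => /predU1P[size_u|lt_un] lt_m.
  (* A prefix of full length determines [z], so its probability is the gCRSF mass itself, and
     [R(n, l) = 1]. *)
  have u_size : size u == n by apply/eqP.
  have -> : prefix_event u = z @^-1` [set Tuple u_size].
    apply/funext => w; apply/propext; rewrite /prefix_event/= size_u.
    rewrite take_oversize ?size_tuple//; split=> [zw|->//].
    exact: val_inj.
  have := z_law (Tuple u_size); rewrite /distribution/= /pushforward => ->.
  rewrite /gCRSF/=; case: ifPn => // u_label.
  have := gCRSF_weightE gamma0 a p (t := Tuple u_size) u_label.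
  by rewrite /gCRSF/= u_label => ->; rewrite size_u predR_top mulr1.
have {}IHm k : P (prefix_event (rcons u k)) =
    (if appearance_order (rcons u k) then
    gCRSF_weight gamma0 a p (rcons u k) *
      predR n gamma0 a p (size u).+1 (nb_clusters (rcons u k)) / normalizer
    else 0)%:E.
  rewrite IHm ?size_rcons//.
  by rewrite subnS -ltnS prednK// subn_gt0.
rewrite prefix_event_series//; under eq_eseriesr do rewrite IHm.
case: ifPn => u_label; last first.
  rewrite eseries0// => k _ _.
  by rewrite appearance_order_rcons (negbTE u_label).
set l := nb_clusters u.
(* Only the labels from 1 to [l + 1] are admissible: the tail from [l + 2] on vanishes here, and the
   label 0 is dropped below. The terms are nonnegative because, by [IHm], they are probabilities. *)
rewrite (nneseries_split 0 l.+2); last first.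
  by move=> k _; rewrite -IHm.
rewrite add0n [X in (_ + X)%E]eseries0 ?adde0; last first.
  move=> k lt_lk _.
  rewrite appearance_order_rcons u_label mem_appearance_order//.
  by rewrite [(k <= _)%N]leqNgt (ltnW lt_lk) andbF gtn_eqF.
rewrite sumEFin; congr (_%:E).
rewrite big_ltn// appearance_order_rcons u_label mem_appearance_order//= add0r.
rewrite big_nat_recr//= -(sum_gCRSF_weight_rcons gamma0 p a_lt1 u_label lt_un).
rewrite mulrDl; congr (_ + _).
  rewrite mulr_suml; apply: eq_big_nat => k k_l.
  rewrite appearance_order_rcons nb_clusters_rcons u_label.
  by rewrite mem_appearance_order//= k_l.
rewrite appearance_order_rcons nb_clusters_rcons u_label.
by rewrite mem_appearance_order//= ltnn eqxx.
Qed.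

Lemma normalizer_neq0 : normalizer != 0.
Proof.
apply/negP => /eqP norm0.
have := prefix_probability (leq0n n : (size [::] <= n)%N).
(* Since [0^-1 = 0], a zero normaliser would give probability 0 to the empty prefix, whose event is
   the whole space. *)
rewrite norm0 invr0 mulr0 if_same.
have -> : prefix_event [::] = setT.
  by apply/seteqP; split=> // w _; exact: take0.
by rewrite probability_setT => /eqP; rewrite eqe oner_eq0.
Qed.

(** The normaliser cancels in the quotient of two prefix probabilities. If the conditioning event is
    null, both sides are 0 by the convention [x / 0 = 0]. *)
Lemma cond_prob_rcons (s : seq nat) (k : nat) : gamma0 * p `^ (- a) != 0 ->
  (size s < n)%N -> appearance_order (rcons s k) ->
  cond_prob P [set w | nth 0%N (z w) (size s) = k] (prefix_event s) =
  gCRSF_weight gamma0 a p (rcons s k) / gCRSF_weight gamma0 a p s *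
  (predR n gamma0 a p (size s).+1 (nb_clusters (rcons s k)) /
   predR n gamma0 a p (size s) (nb_clusters s)).
Proof.
move=> g_neq0 lt_sn sk_label.
have s_label : appearance_order s.
  by move: sk_label; rewrite appearance_order_rcons => /andP[].
rewrite /cond_prob -prefix_event_rcons//.
rewrite !prefix_probability ?size_rcons ?(ltnW lt_sn)//.
by rewrite sk_label s_label/= mulf_div invf_div mulrA divfK ?normalizer_neq0.
Qed.

End prefix_probability.

Theorem corollary4 (R : realType) (d : measure_display) (T : measurableType d)
    (P : probability T R) (a p gamma0 : R) (n : nat)
    (z : {RV P >-> n.-tuple nat})
    (a_lt1 : a < 1) (p_gt0 : 0 < p) (p_lt1 : p < 1) (gamma0_gt0 : 0 < gamma0)
    (n_ge2 : (2 <= n)%N)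
    (z_law : forall t : n.-tuple nat,
       distribution P z [set t] = (gCRSF gamma0 a p t)%:E)
    (i : nat) (i_ge1 : (1 <= i)%N) (i_ltn : (i < n)%N)
    (s : i.-tuple nat) (s_label : appearance_order s) :
  let l := nb_clusters s in
  let next (k : nat) : R :=
    cond_prob P [set w | nth 0%N (z w) i = k] [set w | take i (z w) = s] in
  (forall k : nat, (1 <= k <= l)%N ->
     next k = ((cluster_size s k)%:R - a) *
       (predR n gamma0 a p i.+1 l / predR n gamma0 a p i l)) /\
  next l.+1 = gamma0 * p `^ (- a) *
    (predR n gamma0 a p i.+1 l.+1 / predR n gamma0 a p i l).
Proof.
move=> l next.
have g_neq0 : gamma0 * p `^ (- a) != 0 by rewrite mulf_neq0 ?gt_eqF ?powR_gt0.
(* Needed to cancel the weight of [s], which leaves only the factor of the appended label. *)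
have w_neq0 := gCRSF_weight_neq0 a_lt1 s_label g_neq0.
have nextE k : appearance_order (rcons s k) -> next k =
  gCRSF_weight gamma0 a p (rcons s k) / gCRSF_weight gamma0 a p s *
  (predR n gamma0 a p i.+1 (nb_clusters (rcons s k)) / predR n gamma0 a p i l).
  move=> sk_label.
  have := cond_prob_rcons a_lt1 z_law g_neq0 _ sk_label.
  by rewrite size_tuple; exact.
split=> [k k_l|].
  have k_s : k \in val s by rewrite mem_appearance_order.
  rewrite nextE ?appearance_order_rcons ?s_label ?k_s// gCRSF_weight_old//.
  by rewrite [X in X * _ = _]mulrAC divff// mul1r nb_clusters_rcons k_s.
rewrite nextE ?appearance_order_rcons ?s_label ?eqxx ?orbT// gCRSF_weight_new//.
rewrite [X in X * _ = _]mulrAC divff// mul1r nb_clusters_rcons.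
by rewrite mem_appearance_order// ltnn andbF.
Qed.
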